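(* Let $S_n$ be the star on $n\ge 2$ vertices and let $k\ge 2$ be an integer. Then the spectrum (multiset of eigenvalues, exponents denoting multiplicities) of the adjacency matrix of the power hypergraph $(S_n)^k$ is $$\{(-1)^{(n-1)(k-2)},\ (k-2)^{n-2},\ r^+,\ r^-\},$$ where $r^+$ and $r^-$ are the roots of $x^2-(k-2)x-(n-1)(k-1)=0$.
   Context: A hypergraph $\mathcal{H}=(V,E)$ consists of a finite vertex set $V$ and a set $E$ of edges, each a subset of $V$ of cardinality at least $2$. For $i\neq j$, $d(\{i,j\})$ is the number of edges containing both $i$ and $j$; the adjacency matrix has zero diagonal and $(i,j)$ entry $d(\{i,j\})$. The star $S_n$ is the graph on $n$ vertices with one central vertex adjacent to all $n-1$ others and no other edges. For a graph $\mathcal{G}$ and integer $k\ge2$, the power hypergraph $\mathcal{G}^k$ is the $k$-uniform hypergraph obtained by adding, for each edge $e\in E(\mathcal{G})$, $k-2$ new vertices $\varsigma_e=\{v^e_1,\dots,v^e_{k-2}\}$ (distinct for distinct edges) and taking as edges the sets $e\cup\varsigma_e$, $e\in E(\mathcal{G})$; its vertex set is $V(\mathcal{G})\cup\bigcup_e\varsigma_e$. *)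

(* Defs.v *)
From HB Require Import structures.
From mathcomp Require Import all_boot all_order all_algebra.

Set Implicit Arguments.
Unset Strict Implicit.
Unset Printing Implicit Defensive.

Import GRing.Theory.
Local Open Scope ring_scope.

Record hypergraph (V : finType) := Hypergraph {
  edges :> {set {set V}};
  edges_ge2 : forall e, e \in edges -> (2 <= #|e|)%N }.

Definition codegree (V : finType) (H : hypergraph V) (i j : V) : nat :=
  #|[set e in edges H | (i \in e) && (j \in e)]|.

(* Rows and columns follow the enumeration of V, which only matters up to
   simultaneous permutation. *)
Definition adjacency (R : nzRingType) (V : finType) (H : hypergraph V) :
    'M[R]_#|V| :=
  \matrix_(i, j)
    if i == j then 0 else (codegree H (enum_val i) (enum_val j))%:R.

(* Simple graphs are the 2-uniform hypergraphs. *)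
Record graph (V : finType) := Graph {
  graph_hypergraph :> hypergraph V;
  graph_edges2 : forall e, e \in edges graph_hypergraph -> #|e| = 2 }.

(* The vertex 0 of 'I_n is the centre. *)
Definition star_edges (n : nat) : {set {set 'I_n}} :=
  [set [set c; i] | c in [set c : 'I_n | val c == 0%N],
                    i in [set i : 'I_n | val i != 0%N]].

Fact star_edges2 n e : e \in star_edges n -> #|e| = 2.
Proof.
case/imset2P=> c i; rewrite !inE => /eqP c0 i0 ->.
by rewrite cards2 -val_eqE /= c0 eq_sym i0.
Qed.

Fact star_edges_ge2 n e : e \in star_edges n -> (2 <= #|e|)%N.
Proof. by move/star_edges2 => ->. Qed.

Definition star (n : nat) : graph 'I_n :=
  @Graph _ (Hypergraph (@star_edges_ge2 n)) (@star_edges2 n).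

Section Power.
Variables (V : finType) (G : graph V) (k : nat).

(* inr (e, t) is the new vertex number t attached to the edge e. *)
Definition power_vertex : finType :=
  (V + {e : {set V} | e \in edges G} * 'I_(k - 2))%type.

Definition power_edge (e : {e : {set V} | e \in edges G}) :
    {set power_vertex} :=
  [set inl v | v in val e] :|: [set inr (e, t) | t : 'I_(k - 2)].

Definition power_edges : {set {set power_vertex}} :=
  [set power_edge e | e : {e : {set V} | e \in edges G}].

Fact card_power_edge e : #|power_edge e| = (2 + (k - 2))%N.
Proof.
rewrite cardsU disjoint_setI0 ?cards0 ?subn0.
  rewrite !card_imset ?card_ord ?(graph_edges2 (valP e)) //.
    by move=> s t [].
  by move=> u v [].
rewrite -setI_eq0; apply/eqP/setP=> x; rewrite !inE.
by apply/negP=> /andP[/imsetP[v _ ->] /imsetP[]].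
Qed.

Fact power_edges_ge2 e : e \in power_edges -> (2 <= #|e|)%N.
Proof. by case/imsetP=> f _ ->; rewrite card_power_edge leq_addr. Qed.

Definition power_hypergraph : hypergraph power_vertex :=
  Hypergraph power_edges_ge2.

End Power.

(* The sequence s, read as a multiset, consists of all the roots of the monic
   polynomial p, with multiplicity.  It is unique up to permutation, and p
   is required to split. *)
Definition is_roots (R : idomainType) (p : {poly R}) (s : seq R) : Prop :=
  p = \prod_(x <- s) ('X - x%:P).

Definition is_spectrum (R : idomainType) (m : nat) (A : 'M[R]_m)
    (s : seq R) : Prop :=
  is_roots (char_poly A) s.

(* Main.v *)
(* If N is the vertex-edge incidence matrix of a hypergraph and D the diagonal
   matrix of its degrees, the adjacency matrix is A = N N^T - D, so
   x - A = (x + D) (1 - (x + D)^-1 N N^T).  By the identity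
   det (1 - B C) = det (1 - C B), the determinant is that of x + D times
   det (1 - N^T (x + D)^-1 N), whose size is the number l = n - 1 of edges.  For
   the power of a star, two distinct edges meet only in the centre, of degree
   l, and all other degrees are 1, hence
   N^T (x + D)^-1 N = (k - 1) / (x + 1) I + 1 / (x + l) J, with J the all-ones
   matrix.  This gives the characteristic polynomial at every large integer x. *)
Require Import Defs.
From HB Require Import structures.
From mathcomp Require Import all_boot all_order all_algebra.
From mathcomp Require Import ring lra.

Import GRing.Theory Num.Theory.
Local Open Scope ring_scope.

(** The block matrix with rows [1, A] and [B, 1] is factored as lower times upper triangular and as
    upper times lower; the two determinants are compared. *)
Lemma det_1sub_mulmxC (R : comNzRingType) (m n : nat)
    (A : 'M[R]_(m, n)) (B : 'M[R]_(n, m)) :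
  \det (1%:M - A *m B) = \det (1%:M - B *m A).
Proof.
have L : block_mx 1%:M A B 1%:M
    = block_mx 1%:M 0 B 1%:M *m block_mx 1%:M A 0 (1%:M - B *m A).
  by rewrite mulmx_block !mul1mx !mulmx1 !mul0mx !addr0 addrC subrK.
have U : block_mx 1%:M A B 1%:M
    = block_mx (1%:M - A *m B) A 0 1%:M *m block_mx 1%:M 0 B 1%:M.
  by rewrite mulmx_block !mul1mx !mulmx1 !mulmx0 !add0r subrK.
move: (congr1 determinant L); rewrite {1}U !det_mulmx !det_ublock !det_lblock.
by rewrite !det1 !mulr1 !mul1r.
Qed.

(** A constant matrix is a column times a row, so exchanging the factors leaves a determinant of
    size 1. *)
Lemma det_scalar_sub_const (F : fieldType) (l : nat) (a b : F) : a != 0 ->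
  \det (a%:M - const_mx b : 'M[F]_l) = a ^+ l * (1 - l%:R * b / a).
Proof.
move=> a0.
have -> : a%:M - const_mx b
    = a *: (1%:M - const_mx (b / a) *m (const_mx 1 : 'M_(1, l))) :> 'M[F]_l.
  apply/matrixP=> i j; rewrite !mxE big_ord1 !mxE mulr1 mulrBr mulrCA divff //.
  by rewrite mulr1 mulr_natr.
rewrite detZ det_1sub_mulmxC det_mx11 !mxE eqxx.
under eq_bigr => i _ do rewrite !mxE mul1r.
by rewrite sumr_const card_ord -[(b / a) *+ l]mulr_natl mulrA.
Qed.

Lemma horner_char_poly (R : comNzRingType) (n : nat) (A : 'M[R]_n) (x : R) :
  (char_poly A).[x] = \det (x%:M - A).
Proof.
rewrite -horner_evalE -det_map_mx; congr (\det _); apply/matrixP=> i j.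
by rewrite !mxE /= /horner_eval !hornerE hornerMn hornerX.
Qed.

(** Otherwise [p - q] would have as many distinct roots as its size, one more than its degree.
    Working with values at large integers allows division by [x] plus a degree without rational
    functions. *)
Lemma poly_eq_at_large_nat (R : numDomainType) (p q : {poly R}) (m : nat) :
  (forall i, (m <= i)%N -> p.[i%:R] = q.[i%:R]) -> p = q.
Proof.
move=> pq; apply/eqP; rewrite -subr_eq0; apply/negPn/negP=> nz.
suff: (size (p - q)%R < size (p - q)%R)%N by rewrite ltnn.
rewrite -[X in (X < _)%N](size_iota m (size (p - q)%R)) -(size_map (fun i => i%:R : R)).
apply: max_poly_roots => //.
  apply/allP=> x /mapP[i]; rewrite mem_iota => /andP[mi _] ->.
  by rewrite /root hornerD hornerN pq // subrr.
by rewrite map_inj_uniq ?iota_uniq //; apply: mulrIn; rewrite oner_eq0.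
Qed.

Lemma codegree_sum (V : finType) (H : hypergraph V) (l : nat)
    (S : 'I_l -> {set V}) (u v : V) :
  injective S -> edges H = [set S j | j : 'I_l] ->
  codegree H u v = (\sum_j ((u \in S j) && (v \in S j)))%N.
Proof.
move=> injS HS; rewrite /codegree HS.
have -> : [set e in [set S j | j : 'I_l] | (u \in e) && (v \in e)]
    = S @: [set j | (u \in S j) && (v \in S j)].
  apply/setP=> e; rewrite inE; apply/andP/imsetP=> [[/imsetP[j _ ->] uv]|[j]].
    by exists j; rewrite ?inE.
  by rewrite inE => uv ->; rewrite imset_f.
by rewrite card_imset // -sum1dep_card big_mkcond.
Qed.

Lemma char_poly_adjacency (F : fieldType) (V : finType) (H : hypergraph V)
    (l : nat) (S : 'I_l -> {set V}) (x : F) :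
  injective S -> edges H = [set S j | j : 'I_l] ->
  (forall v, x + (codegree H v v)%:R != 0) ->
  (char_poly (adjacency F H)).[x] =
    \prod_v (x + (codegree H v v)%:R)
    * \det (1%:M - \matrix_(i, j)
        \sum_(v in S i :&: S j) (x + (codegree H v v)%:R)^-1).
Proof.
move=> injS HS nz; rewrite horner_char_poly.
pose d v := x + (codegree H v v)%:R.
have codegE u v : (codegree H u v)%:R
    = \sum_j ((u \in S j) && (v \in S j))%:R :> F.
  by rewrite -natr_sum (codegree_sum _ _ _ _ _ _ injS HS).
pose D := diag_mx (\row_(i < #|V|) d (enum_val i)).
pose N := \matrix_(i < #|V|, j < l) (enum_val i \in S j)%:R : 'M[F]_(_, _).
(* [M] is the inverse of [D] times [N]. *)
pose M := \matrix_(i < #|V|, j < l) ((d (enum_val i))^-1 * N i j).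
have DM : D *m M = N.
  apply/matrixP=> i j; rewrite mul_diag_mx !mxE mulrA divff ?mul1r //.
  exact: nz.
have -> : x%:M - adjacency F H = D *m (1%:M - M *m N^T).
  rewrite mulmxBr mulmx1 mulmxA DM; apply/matrixP=> i j; rewrite !mxE.
  under eq_bigr => s _ do rewrite !mxE -natrM mulnb.
  (* On the diagonal, [N *m N^T] has the degree, which cancels the one in [d] and leaves [x]. *)
  rewrite -codegE; case: eqP => [->|_]; last by rewrite !mulr0n.
  by rewrite /d !mulr1n subr0 addrK.
rewrite det_mulmx det_1sub_mulmxC det_diag [in RHS]big_enum_val /=.
congr (_ * _); first by apply: eq_bigr => i _; rewrite mxE.
congr (\det (_ - _)).
apply/matrixP=> i j; rewrite !mxE [RHS]big_mkcond [RHS]big_enum_val /=.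
apply: eq_bigr => s _; rewrite !mxE inE mulrCA -natrM mulnb mulr_natr.
by case: (_ && _).
Qed.

Section PowerStar.
Variables (l k : nat).
Let E := {e : {set 'I_l.+1} | e \in edges (star l.+1)}.
Let H := power_hypergraph (star l.+1) k.

Fact ray_subproof (j : 'I_l) : [set ord0; lift ord0 j] \in edges (star l.+1).
Proof. by apply/imset2P; exists ord0 (lift ord0 j); rewrite ?inE. Qed.

(** Labelling each edge by its leaf makes ['I_l] the index type for the columns of the incidence
    matrix. *)
Definition ray (j : 'I_l) : E := exist (fun e => e \in edges (star l.+1)) _ (ray_subproof j).

Lemma ray_inj : injective ray.
Proof.
move=> i j /(congr1 val) /= /setP /(_ (lift ord0 i)).
by rewrite !inE eqxx orbT /= => /esym/eqP/lift_inj.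
Qed.

Lemma ray_surj (e : E) : exists j, e = ray j.
Proof.
case: e => e he; have := he; case/imset2P=> c i; rewrite !inE => /eqP c0 i0 eE.
have {}c0 : c = ord0 by apply: val_inj.
case: (unliftP ord0 i) => [j ij|i0']; last by rewrite i0' in i0.
by exists j; apply: val_inj; rewrite /= eE c0 ij.
Qed.

Lemma big_ray (T : Type) (idx : T) (op : Monoid.com_law idx) (f : E -> T) :
  \big[op/idx]_e f e = \big[op/idx]_j f (ray j).
Proof.
have [g rK gK] : bijective ray.
  apply: inj_card_bij ray_inj _; rewrite -[X in (_ <= X)%N](card_codom ray_inj).
  by apply: subset_leq_card; apply/subsetP=> e _; have [j ->] := ray_surj e; apply: codom_f.
by rewrite (reindex ray) //; exists g => ? _.
Qed.

Lemma mem_power_ray_inl v j :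
  (inl v \in power_edge k (ray j)) = (v == ord0) || (v == lift ord0 j).
Proof.
rewrite !inE mem_imset; last by move=> ? ? [].
rewrite !inE; apply/orb_idr=> /imsetP[t _ //].
Qed.

Lemma mem_power_ray_inr e t j :
  (inr (e, t) \in power_edge k (ray j)) = (e == ray j).
Proof.
rewrite !inE; apply/orP/eqP=> [[/imsetP[v _ //]|/imsetP[s _ [-> _ //]]]|->].
by right; apply/imsetP; exists t.
Qed.

Lemma power_ray_inj : injective (fun j => power_edge k (ray j)).
Proof.
move=> i j /setP /(_ (inl (lift ord0 i))).
by rewrite !mem_power_ray_inl eqxx orbT /= => /esym/eqP/lift_inj.
Qed.

Lemma edges_power_star : edges H = [set power_edge k (ray j) | j : 'I_l].
Proof.
apply/setP=> e; apply/imsetP/imsetP=> [[f _ ->]|[j _ ->]]; last by exists (ray j).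
by have [j ->] := ray_surj f; exists j.
Qed.

Let codegreeE u v := codegree_sum _ _ _ _ u v power_ray_inj edges_power_star.

Lemma degree_center : codegree H (inl ord0) (inl ord0) = l.
Proof.
rewrite codegreeE; under eq_bigr => j _ do rewrite mem_power_ray_inl.
by rewrite sum1_card card_ord.
Qed.

Lemma degree_leaf i :
  codegree H (inl (lift ord0 i)) (inl (lift ord0 i)) = 1%N.
Proof.
rewrite codegreeE; under eq_bigr => j _ do
  rewrite mem_power_ray_inl /= (inj_eq lift_inj) andbb.
by rewrite (bigD1 i) //= eqxx big1 // => j; rewrite eq_sym => /negPf->.
Qed.

Lemma degree_new e t : codegree H (inr (e, t)) (inr (e, t)) = 1%N.
Proof.
rewrite codegreeE; under eq_bigr => j _ do rewrite mem_power_ray_inr andbb.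
have [i ->] := ray_surj e.
under eq_bigr => j _ do rewrite (inj_eq ray_inj).
by rewrite (bigD1 i) //= eqxx big1 // => j; rewrite eq_sym => /negPf->.
Qed.

Lemma horner_char_poly_power_star (F : fieldType) (x : F) : (0 < l)%N -> (2 <= k)%N ->
  x + l%:R != 0 -> x + 1 != 0 -> x - (k%:R - 2) != 0 ->
  (char_poly (adjacency F H)).[x] =
    (x + 1) ^+ (l * (k - 2)) * (x - (k%:R - 2)) ^+ l.-1
    * (x ^+ 2 - (k%:R - 2) * x - l%:R * (k%:R - 1)).
Proof.
move=> l_gt0 hk a0 b0 c0.
rewrite (char_poly_adjacency _ _ _ _ _ _ power_ray_inj edges_power_star); last first.
  case=> [v|[e t]]; last by rewrite degree_new.
  by case: (unliftP ord0 v) => [i ->|->]; rewrite ?degree_leaf ?degree_center.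
have -> : \prod_v (x + (codegree H v v)%:R)
    = (x + l%:R) * (x + 1) ^+ l * (x + 1) ^+ (l * (k - 2)).
  rewrite big_sumType big_ord_recl degree_center /=.
  congr (_ * _ * _).
    by under eq_bigr => i _ do rewrite degree_leaf; rewrite prodr_const card_ord.
  rewrite (eq_bigr (fun=> x + 1)) => [|[e t] _]; last by rewrite degree_new.
  rewrite prodr_const card_prod card_ord.
  by rewrite -sum1_card big_ray sum1_card card_ord.
(* This is [1 - (k - 1) / (x + 1)]: besides the centre, an edge has [k - 1] vertices, its leaf and
   [k - 2] new ones, all of degree 1. *)
pose c := (x - (k%:R - 2)) / (x + 1).
have -> : 1%:M - \matrix_(i < l, j < l)
      \sum_(v in power_edge k (ray i) :&: power_edge k (ray j))
        (x + (codegree H v v)%:R)^-1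
    = c%:M - const_mx (x + l%:R)^-1.
  apply/matrixP=> i j; rewrite !mxE big_mkcond big_sumType big_ord_recl /=.
  rewrite degree_center inE !mem_power_ray_inl /=.
  (* The centre has given [(x + l)^-1] in every entry; leaves, and below them new vertices,
     contribute only on the diagonal. *)
  have -> : \sum_(t < l) (if inl (lift ord0 t) \in
      power_edge k (ray i) :&: power_edge k (ray j)
      then (x + (codegree H (inl (lift ord0 t)) (inl (lift ord0 t)))%:R)^-1
      else 0) = (x + 1)^-1 *+ (i == j).
    under eq_bigr => t _ do
      rewrite inE !mem_power_ray_inl /= !(inj_eq lift_inj) degree_leaf.
    rewrite (bigD1 i) //= eqxx /= big1 ?addr0 => [|t /negPf-> //].
    by case: eqP.
  rewrite (eq_bigr (fun e => if (e.1 == ray i) && (e.1 == ray j)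
    then (x + 1)^-1 else 0)) => [|[e t] _]; last first.
    by rewrite inE !mem_power_ray_inr degree_new.
  rewrite -(pair_bigA _ (fun e _ => if (e == ray i) && (e == ray j)
    then (x + 1)^-1 else 0)) /= big_ray.
  under eq_bigr => t _ do rewrite sumr_const card_ord !(inj_eq ray_inj).
  rewrite (bigD1 i) //= eqxx big1 ?addr0; last first.
    by move=> t /negPf->; rewrite mul0rn.
  case: eqP => _; last by rewrite /= !mulr0n mul0rn !addr0.
  rewrite !mulr1n -[(x + 1)^-1 *+ _]mulr_natl natrB // /c.
  by field; rewrite a0 b0.
rewrite det_scalar_sub_const; last by rewrite mulf_neq0 ?invr_neq0.
(* One factor of [c ^+ l] is split off: with [x + l], [x + 1] and the last factor of the determinant
   it makes up the quadratic. The remaining power of [x + 1] is abstracted as a nonzero [B] for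
   [field]. *)
rewrite /c expr_div_n; case: l a0 l_gt0 => // l' a0 _; rewrite /= !exprS.
have := expf_neq0 l' b0; move: ((x + 1) ^+ l') => B B0.
by field; rewrite b0 c0 B0 nat1r a0.
Qed.

End PowerStar.

Lemma quadratic_roots (R : rcfType) (b c : R) : 0 <= b ^+ 2 + 4 * c ->
  let s := Num.sqrt (b ^+ 2 + 4 * c) in
  is_roots ('X^2 - b%:P * 'X - c%:P) [:: (b + s) / 2; (b - s) / 2].
Proof.
move=> d0 s; have s2 : s ^+ 2 = b ^+ 2 + 4 * c by rewrite sqr_sqrtr.
rewrite /is_roots !big_cons big_nil mulr1.
(* Vieta: [b] is the sum of the roots and [- c] their product. *)
have -> : c = - ((b + s) / 2 * ((b - s) / 2)) by field: s2.
have {1}-> : b = (b + s) / 2 + (b - s) / 2 by field.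
by rewrite !rmorphN !rmorphD !rmorphM /=; ring.
Qed.

Theorem theorem2 (R : rcfType) (n k : nat) (hn : (2 <= n)%N) (hk : (2 <= k)%N) :
  exists rp rm : R,
    is_roots ('X^2 - (k%:R - 2)%:P * 'X - ((n%:R - 1) * (k%:R - 1))%:P)
             [:: rp; rm] /\
    is_spectrum (adjacency R (power_hypergraph (star n) k))
      (nseq ((n - 1) * (k - 2)) (-1) ++ nseq (n - 2) (k%:R - 2) ++ [:: rp; rm]).
Proof.
case: n hn => // l hl.
have n1 : l.+1%:R - 1 = l%:R :> R by rewrite -natr1 addrK.
have k1 : 1 <= k%:R :> R by rewrite ler1n ltnW.
have /quadratic_roots Q : 0 <= (k%:R - 2) ^+ 2 + 4 * ((l.+1%:R - 1) * (k%:R - 1)) :> R.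
  by rewrite n1 addr_ge0 ?sqr_ge0 // !mulr_ge0
    ?ler0n ?subr_ge0.
eexists; eexists; split; first exact: Q.
(* Folding the last two linear factors back into the quadratic removes the square roots. *)
rewrite /is_spectrum /is_roots big_cat big_cat /= -Q !big_nseq -!Monoid.iteropE /=.
(* From [k] on, [x + l], [x + 1] and [x - (k - 2)] are all positive. *)
apply: (@poly_eq_at_large_nat _ _ _ k) => i ki.
have l0 : 0 <= l%:R :> R by rewrite ler0n.
have {}ki : k%:R <= i%:R :> R by rewrite ler_nat.
rewrite horner_char_poly_power_star //; first last.
- by apply/eqP; lra.
- by apply/eqP; lra.
- by apply/eqP; lra.
by rewrite !hornerE n1 !subSS subn0 subn1 opprK.
Qed.
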